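(* (Triple quad formula) Let $A_1,A_2,A_3$ be points of the affine line over a field, and define the quadrances $Q_1\equiv Q(A_2,A_3)$, $Q_2\equiv Q(A_1,A_3)$ and $Q_3\equiv Q(A_1,A_2)$. Then $$(Q_1+Q_2+Q_3)^2=2\left(Q_1^2+Q_2^2+Q_3^2\right).$$
   Context: Fix a field, whose elements are called numbers. A point of the affine line is $A=[x]$ with $x$ a number. The quadrance between points $A=[x]$ and $B=[y]$ is the number $Q(A,B)\equiv (y-x)^2$. *)

(* Defs.v *)
From mathcomp Require Import all_boot all_algebra.

Set Implicit Arguments.
Unset Strict Implicit.
Unset Printing Implicit Defensive.

Import GRing.Theory.
Local Open Scope ring_scope.

(* [Point x] is the point of the affine line with coordinate [x]. *)
Record point (F : fieldType) := Point { coord : F }.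

Definition quadrance (F : fieldType) (A B : point F) : F :=
  (coord B - coord A) ^+ 2.

(* Main.v *)
Require Import Defs.
From mathcomp Require Import all_boot all_algebra.
From mathcomp Require Import ring.

Local Open Scope ring_scope.

(** Write the quadrances as squares of the differences a = x3 - x2,
    b = x3 - x1, c = x2 - x1.  Heron's factorization
      (a^2 + b^2 + c^2)^2 - 2 (a^4 + b^4 + c^4)
        = (a + b + c) (a + b - c) (a - b + c) (- a + b + c)
    holds in every commutative ring, and its third factor vanishes because
    b = a + c.  So the formula is a polynomial identity in the three
    coordinates, valid in every characteristic. *)
Theorem theorem1 (F : fieldType) (A1 A2 A3 : point F) (Q1 Q2 Q3 : F)
  (hQ1 : Q1 = quadrance A2 A3)
  (hQ2 : Q2 = quadrance A1 A3)
  (hQ3 : Q3 = quadrance A1 A2) :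
  (Q1 + Q2 + Q3) ^+ 2 = 2%:R * (Q1 ^+ 2 + Q2 ^+ 2 + Q3 ^+ 2).
Proof. by rewrite hQ1 hQ2 hQ3 /quadrance; ring. Qed.
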